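(* Let $(\psi,q_C,q_V)$ be a smooth solution of the magnetic oriented nodal analysis (MONA) system $$ \begin{aligned} A_R G(A_R^\top \tfrac{d}{dt}\psi) A_R^\top \tfrac{d}{dt}\psi + A_C \tfrac{d}{dt} q_C + A_V \tfrac{d}{dt} q_V &= -A_L \nabla\epsilon_L(A_L^\top\psi) - A_I i_{src},\\ -A_C^\top \tfrac{d}{dt}\psi &= -\nabla\epsilon_C(q_C),\\ -A_V^\top \tfrac{d}{dt}\psi &= -v_{src}, \end{aligned} $$ where $G(v)$ is symmetric and positive definite for every $v$. Set $\phi_L=A_L^\top\psi$, $i_V=\frac{d}{dt}q_V$ and $v_I=A_I^\top\frac{d}{dt}\psi$. Then $$ \frac{d}{dt}\Big(\epsilon_L(\phi_L)+\epsilon_C(q_C)\Big) = -\big\langle A_R G(A_R^\top \tfrac{d}{dt}\psi) A_R^\top \tfrac{d}{dt}\psi,\ \tfrac{d}{dt}\psi\big\rangle - \langle i_{src}, v_I\rangle - \langle i_V, v_{src}\rangle . $$ In particular, in the absence of source terms ($i_{src}=0$ and $v_{src}=0$) the system is passive, i.e. the energy $\epsilon_L(\phi_L)+\epsilon_C(q_C)$ is non-increasing in time along solutions.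
   Context: A directed connected graph with $N_n$ nodes and $N_b$ branches has incidence matrix $A\in\mathbb{R}^{N_n\times N_b}$ with $A_{ij}=1$ if branch $j$ leaves node $i$, $A_{ij}=-1$ if branch $j$ enters node $i$, and $A_{ij}=0$ otherwise. The same letter $A$ denotes the reduced incidence matrix obtained by deleting the row of one grounded node. The branches are grouped into capacitors, inductors, resistors, voltage sources and current sources, and $A=[A_C,A_L,A_R,A_V,A_I]$ is the corresponding splitting of the columns into partial incidence matrices. $\psi$ is the vector of magnetic node potentials (one entry per non-grounded node); $q_C$ and $q_V$ are the vectors of charges at capacitors and voltage sources; $i_{src}(t)$ and $v_{src}(t)$ are prescribed source currents and voltages. $G(\cdot)$ is a smooth matrix-valued function on the space of resistor voltages (the generalized conductance matrix), and $\epsilon_L$, $\epsilon_C$ are smooth real-valued functions (magnetic energy of the inductors and electric energy of the capacitors). $\langle a,b\rangle=b^\top a$ is the Euclidean inner product. *)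

(* Defs.v *)
From HB Require Import structures.
From mathcomp Require Import all_boot all_order all_algebra.
From mathcomp Require Import all_classical all_reals all_analysis.

Set Implicit Arguments.
Unset Strict Implicit.
Unset Printing Implicit Defensive.

Import Order.TTheory GRing.Theory Num.Theory.
Import numFieldNormedType.Exports.

Local Open Scope ring_scope.
Local Open Scope classical_set_scope.

(* The n.+1 nodes include the grounded one, so that n is the number of node
   potentials. The branches are ordered as capacitors, inductors, resistors,
   voltage sources, current sources; parallel branches are allowed.
   Connectedness is that of the underlying undirected graph. *)
Record circuit_graph (n mC mL mR mV mI : nat) := CircuitGraph {
  leaves : 'I_(mC + mL + mR + mV + mI) -> 'I_n.+1;
  enters : 'I_(mC + mL + mR + mV + mI) -> 'I_n.+1;
  ground : 'I_n.+1;
  graph_connected : forall x y : 'I_n.+1,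
    connect (fun a b => [exists j, ((leaves j == a) && (enters j == b))
                                || ((leaves j == b) && (enters j == a))]) x y
}.

Section incidence.
Context (R : realType) (n mC mL mR mV mI : nat).
Variable g : circuit_graph n mC mL mR mV mI.

(* The entry is 1 if branch j leaves node i, -1 if it enters node i, and 0
   otherwise; a self-loop, which does both, gives a zero column. *)
Definition full_incidence : 'M[R]_(n.+1, mC + mL + mR + mV + mI) :=
  \matrix_(i, j) ((i == leaves g j)%:R - (i == enters g j)%:R).

Definition incidence : 'M[R]_(n, mC + mL + mR + mV + mI) :=
  row' (ground g) full_incidence.

Definition A_C : 'M[R]_(n, mC) := lsubmx (lsubmx (lsubmx (lsubmx incidence))).
Definition A_L : 'M[R]_(n, mL) := rsubmx (lsubmx (lsubmx (lsubmx incidence))).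
Definition A_R : 'M[R]_(n, mR) := rsubmx (lsubmx (lsubmx incidence)).
Definition A_V : 'M[R]_(n, mV) := rsubmx (lsubmx incidence).
Definition A_I : 'M[R]_(n, mI) := rsubmx incidence.

Lemma incidence_split :
  incidence = row_mx (row_mx (row_mx (row_mx A_C A_L) A_R) A_V) A_I.
Proof. by rewrite /A_C /A_L /A_R /A_V /A_I !hsubmxK. Qed.

End incidence.

Section calculus.
Context (R : realType).

Definition inner n (a b : 'cV[R]_n) : R := (b^T *m a) 0 0.

Definition grad n (f : 'cV[R]_n -> R) (x : 'cV[R]_n) : 'cV[R]_n :=
  \col_i 'D_(delta_mx i 0) f x.

Definition sym_posdef n (M : 'M[R]_n) : Prop :=
  M^T = M /\ forall x : 'cV[R]_n, x != 0 -> 0 < inner (M *m x) x.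

(* All iterated directional derivatives exist and are differentiable on a
   neighbourhood of every point of A. When V is finite-dimensional this is
   C^infinity on an open set containing A, the usual meaning of smoothness on
   a set A that need not be open, such as a closed interval. *)
Definition smooth_on (V W : normedModType R) (A : set V) (f : V -> W) : Prop :=
  forall x, A x -> \forall y \near x, forall vs : seq V,
    differentiable (foldr (fun v (h : V -> W) => 'D_v h) f vs) y.

Definition smooth (V W : normedModType R) (f : V -> W) : Prop :=
  smooth_on setT f.

End calculus.

(* The system at the time t; the data are the element laws G, epsL, epsC, the
   sources isrc, vsrc and the unknowns psi, qC, qV. *)
Definition mona_system (R : realType) (n mC mL mR mV mI : nat)
    (g : circuit_graph n mC mL mR mV mI)
    (G : 'cV[R]_mR -> 'M[R]_mR) (epsL : 'cV[R]_mL -> R) (epsC : 'cV[R]_mC -> R)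
    (isrc : R -> 'cV[R]_mI) (vsrc : R -> 'cV[R]_mV)
    (psi : R -> 'cV[R]_n) (qC : R -> 'cV[R]_mC) (qV : R -> 'cV[R]_mV)
    (t : R) : Prop :=
  [/\ A_R R g *m G ((A_R R g)^T *m derive1 psi t) *m (A_R R g)^T *m derive1 psi t
        + A_C R g *m derive1 qC t + A_V R g *m derive1 qV t
      = - (A_L R g *m grad epsL ((A_L R g)^T *m psi t)) - A_I R g *m isrc t,
      - ((A_C R g)^T *m derive1 psi t) = - grad epsC (qC t)
    & - ((A_V R g)^T *m derive1 psi t) = - vsrc t].

(* Main.v *)
(* By the chain rule the energy has derivative
   <A_L grad epsL(phiL), psi'> + <grad epsC(qC), qC'>.  Pairing the current
   balance with psi' and moving A_C, A_V, A_I across the inner product turns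
   the first term into minus the dissipation and source terms minus
   <qC', A_C^T psi'>, which the capacitor equation identifies with
   <qC', grad epsC(qC)>: it cancels the second term. *)
Require Import Defs.
From HB Require Import structures.
From mathcomp Require Import all_boot all_order all_algebra.
From mathcomp Require Import all_classical all_reals all_analysis.
From mathcomp Require Import lra.

Import Order.TTheory GRing.Theory Num.Theory.
Import numFieldNormedType.Exports.

Local Open Scope ring_scope.
Local Open Scope classical_set_scope.

Section calculus_lemmas.
Set Implicit Arguments.
Unset Strict Implicit.
Context (R : realType).

Lemma innerC n (a b : 'cV[R]_n) : inner a b = inner b a.
Proof. by rewrite /inner !mxE; apply: eq_bigr => i _; rewrite !mxE mulrC. Qed.

Lemma inner_mulmxl m n (A : 'M[R]_(m, n)) a b :
  inner (A *m a) b = inner a (A^T *m b).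
Proof. by rewrite /inner trmx_mul trmxK mulmxA. Qed.

Lemma innerDl n (a b c : 'cV[R]_n) : inner (a + b) c = inner a c + inner b c.
Proof. by rewrite /inner mulmxDr mxE. Qed.

Lemma innerNl n (a c : 'cV[R]_n) : inner (- a) c = - inner a c.
Proof. by rewrite /inner mulmxN mxE. Qed.

Lemma inner0l n (c : 'cV[R]_n) : inner 0 c = 0.
Proof. by rewrite /inner mulmx0 mxE. Qed.

Lemma sym_posdef_inner_ge0 n (M : 'M[R]_n) (x : 'cV[R]_n) :
  sym_posdef M -> 0 <= inner (M *m x) x.
Proof.
move=> [_ M_gt0]; have [->|/M_gt0/ltW//] := eqVneq x 0.
by rewrite mulmx0 inner0l.
Qed.

(** The empty list of directions in [smooth_on] stands for [f] itself, and what holds near [x] holds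
    at [x]. *)
Lemma smooth_on_differentiable (V W : normedModType R) (A : set V) (f : V -> W)
  x : smooth_on A f -> A x -> differentiable f x.
Proof. by move=> f_smooth /f_smooth/nbhs_singleton/(_ [::]). Qed.

(** Derivatives of matrix functions are entrywise, and each entry of the product is a finite sum of
    entries of [u] with constant coefficients. *)
Lemma is_derive_mulmx m n p (A : 'M[R]_(m, n)) (u : R -> 'M[R]_(n, p)) t :
  derivable u t 1 -> is_derive t 1 (fun s => A *m u s) (A *m derive1 u t).
Proof.
move=> du.
have dcoef i j : is_derive t 1 (fun s => (A *m u s) i j)
    (\sum_k A i k * 'D_1 (fun s => u s k j) t).
  have -> : (fun s => (A *m u s) i j) = \sum_k (fun s => A i k *: u s k j).
    by apply/funext => s; rewrite mxE fct_sumE.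
  apply: is_derive_sum => k; apply: is_deriveZ.
  by apply/derivableP; move/derivable_mxP : du; exact.
have dAu : derivable (fun s => A *m u s) t 1.
  by apply/derivable_mxP => i j; exact: @ex_derive _ _ _ _ _ _ _ (dcoef i j).
apply: DeriveDef => //; rewrite derive_mx// derive1E derive_mx//.
apply/matrixP => i j; rewrite !mxE.
have dc := dcoef i j; rewrite derive_val.
by apply: eq_bigr => k _; rewrite mxE.
Qed.

(** By linearity of the differential it suffices to expand [v] in the basis [delta_mx i 0], on which
    the differential gives the partial derivatives that make up [grad]. *)
Lemma diff_inner_grad n (f : 'cV[R]_n -> R) (x v : 'cV[R]_n) :
  differentiable f x -> 'd f x v = inner (grad f x) v.
Proof.
move=> df; rewrite /inner mxE [v in LHS]matrix_sum_delta linear_sum.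
apply: eq_bigr => i _.
by rewrite big_ord1 linearZ /= !mxE deriveE.
Qed.

Lemma is_derive_comp_grad n (f : 'cV[R]_n -> R) (u : R -> 'cV[R]_n) t du :
  differentiable f (u t) -> is_derive t 1 u du ->
  is_derive t 1 (fun s => f (u s)) (inner (grad f (u t)) du).
Proof.
move=> df [u_derivable <-]; have du1 := iffLR (derivable1_diffP _ _) u_derivable.
apply: DeriveDef.
  by apply/derivable1_diffP; exact: (@differentiable_comp _ _ _ _ u f).
rewrite -diff_inner_grad// (deriveE _ du1).
rewrite deriveE; last exact: (@differentiable_comp _ _ _ _ u f).
by rewrite (@diff_comp _ _ _ _ u f).
Qed.

(** Serves the passivity claim. [J] may be of any shape, so the monotonicity criterion is applied on
    the segment from [s] to [t], which lies in [J] by convexity; derivability at its ends supplies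
    the continuity there. *)
Lemma ler0_is_derive_nincr (J : interval R) (f df : R -> R) :
  (forall t, t \in J -> is_derive t 1 f (df t)) ->
  (forall t, t \in J -> df t <= 0) ->
  {in J &, {homo f : s t / s <= t >-> t <= s}}.
Proof.
move=> f_df df_le0 s t sJ tJ st.
have subJ x : x \in `[s, t]%R -> x \in J.
  by move=> xst; apply: (@interval_is_interval _ J s t sJ tJ); rewrite !(itvP xst).
have oc x : x \in `]s, t[%R -> x \in `[s, t]%R.
  exact: subset_itv_oo_cc.
apply: (@ler0_derive1_nincr _ f s t) => //.
- by move=> x /oc/subJ/f_df[].
- by move=> x /oc/subJ xJ; rewrite derive1E; have [_ ->] := f_df _ xJ; exact: df_le0.
- by apply: derivable_within_continuous => x /subJ/f_df[].
Qed.

End calculus_lemmas.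

Theorem mainTheorem2 (R : realType) (n mC mL mR mV mI : nat)
    (g : circuit_graph n mC mL mR mV mI)
    (G : 'cV[R]_mR -> 'M[R]_mR) (epsL : 'cV[R]_mL -> R) (epsC : 'cV[R]_mC -> R)
    (isrc : R -> 'cV[R]_mI) (vsrc : R -> 'cV[R]_mV) (J : interval R)
    (psi : R -> 'cV[R]_n) (qC : R -> 'cV[R]_mC) (qV : R -> 'cV[R]_mV)
    (G_smooth : smooth G) (epsL_smooth : smooth epsL) (epsC_smooth : smooth epsC)
    (G_posdef : forall v : 'cV[R]_mR, sym_posdef (G v))
    (psi_smooth : smooth_on [set` J] psi)
    (qC_smooth : smooth_on [set` J] qC)
    (qV_smooth : smooth_on [set` J] qV)
    (mona : forall t : R, t \in J ->
       mona_system g G epsL epsC isrc vsrc psi qC qV t) :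
  let phiL := fun t : R => (A_L R g)^T *m psi t in
  let iV := fun t : R => derive1 qV t in
  let vI := fun t : R => (A_I R g)^T *m derive1 psi t in
  let energy := fun t : R => epsL (phiL t) + epsC (qC t) in
  (forall t : R, t \in J ->
     derivable energy t 1 /\
     derive1 energy t =
       - inner (A_R R g *m G ((A_R R g)^T *m derive1 psi t)
                  *m (A_R R g)^T *m derive1 psi t) (derive1 psi t)
       - inner (isrc t) (vI t) - inner (iV t) (vsrc t)) /\
  ((forall t : R, t \in J -> isrc t = 0 /\ vsrc t = 0) ->
   forall s t : R, s \in J -> t \in J -> s <= t -> energy t <= energy s).
Proof.
move=> phiL iV vI energy.
have energy_derive t : t \in J -> is_derive t 1 energy
    (- inner (A_R R g *m G ((A_R R g)^T *m derive1 psi t)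
                *m (A_R R g)^T *m derive1 psi t) (derive1 psi t)
     - inner (isrc t) (vI t) - inner (iV t) (vsrc t)).
  move=> tJ; have [kcl gradC gradV] := mona t tJ.
  have diffC := smooth_on_differentiable qC_smooth tJ.
  have diffpsi := smooth_on_differentiable psi_smooth tJ.
  have dphiL := is_derive_mulmx (A_L R g)^T (diff_derivable diffpsi).
  have dqC : is_derive t 1 qC (derive1 qC t).
    by rewrite derive1E; apply/derivableP/diff_derivable.
  have dL := is_derive_comp_grad
    (smooth_on_differentiable epsL_smooth (I : setT (phiL t))) dphiL.
  have dC := is_derive_comp_grad
    (smooth_on_differentiable epsC_smooth (I : setT (qC t))) dqC.
  (* The sum rule, with [dL] and [dC], gives the derivative of [energy]; only the equality of its
     value with the claimed one remains. *)
  apply: is_derive_eq.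
  move/(congr1 (fun v => inner v (derive1 psi t))) : kcl.
  rewrite !innerDl !innerNl (inner_mulmxl (A_C R g)) (inner_mulmxl (A_V R g)).
  rewrite (inner_mulmxl (A_I R g)) (inner_mulmxl (A_L R g)).
  (* Both branch equations are used with their signs cancelled. The swap makes the capacitor term
     match the one from [dC], so that the goal becomes linear in the inner products. *)
  rewrite (oppr_inj gradC) (oppr_inj gradV) (innerC (derive1 qC t)).
  rewrite -/(vI t) -/(iV t) -/(phiL t).
  lra.
split=> [t /energy_derive energy_t|no_source].
  by split; [exact: ex_derive|rewrite derive1E derive_val].
move=> s t sJ tJ; apply: (ler0_is_derive_nincr energy_derive) => // x xJ.
have [-> ->] := no_source x xJ.
(* Moving [A_R R g] across leaves the quadratic form of [G] at the resistor voltages. These may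
   vanish, so the bound is not strict. *)
rewrite (innerC (iV x)) !inner0l !subr0 oppr_le0 -!mulmxA inner_mulmxl.
exact: sym_posdef_inner_ge0.
Qed.
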